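(* Fix a prime power $q$ and an integer $g\ge0$. For $n\ge1$ let $c_n$ be a regular elliptic element of $\mathrm{GL}_n(\mathbb{F}_q)$ and let $N_g(n)$ be the number of pairs $(u,v)\in\mathrm{GL}_n(\mathbb{F}_q)^2$ with $u\cdot v=c_n$ and $n-\dim\ker(u-1)-\dim\ker(v-1)=g$ (genus-$g$ factorizations into two factors). Then as $n\to\infty$, \[N_g(n)=\Theta\!\left(\frac{q^{(n+g)^2/2}}{|\mathrm{GL}_g(\mathbb{F}_q)|}\right),\] where the implicit constants depend on $q$ but not on $g$.
   Context: Regular elliptic element: the image in $\mathrm{GL}_n(\mathbb{F}_q)$ (via an $\mathbb{F}_q$-basis of $\mathbb{F}_{q^n}$, $\sigma$ acting by multiplication) of some $\sigma\in\mathbb{F}_{q^n}$ with $\mathbb{F}_q[\sigma]=\mathbb{F}_{q^n}$; when $n=1$ one additionally requires $c\neq1$. $|\mathrm{GL}_0(\mathbb{F}_q)|=1$. *)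

(* Defs.v *)
From HB Require Import structures.
From mathcomp Require Import all_boot all_order all_algebra all_fingroup all_field.
Set Implicit Arguments. Unset Strict Implicit. Unset Printing Implicit Defensive.
Import Order.TTheory GRing.Theory Num.Theory.
Local Open Scope ring_scope.

(* A regular elliptic element of GL_n(F): the matrix (w.r.t. some F-basis b
   of a degree-n extension L = F_{q^n} of F) of multiplication by some
   sigma in L^x with F[sigma] = L; for n = 1 additionally sigma <> 1.
   Column convention: sigma * b_j = \sum_i A i j *: b_i. *)
Definition regular_elliptic (F : finFieldType) (n : nat) (A : 'M[F]_n) : Prop :=
  exists (L : fieldExtType F) (s : L) (b : n.-tuple L),
    [/\ basis_of fullv b,
        <<1%VS; s>>%VS = fullv,
        s != 0,
        (n == 1)%N ==> (s != 1)
      & forall j : 'I_n, s * b`_j = \sum_(i < n) A i j *: b`_i].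

Definition dimker1 (F : fieldType) (n : nat) (A : 'M[F]_n) : nat :=
  \rank (kermx (A - 1%:M)).

Definition Ngenus (F : finFieldType) (n g : nat) (c : 'M[F]_n) : nat :=
  #|[set p : 'M[F]_n * 'M[F]_n |
      [&& p.1 \in unitmx, p.2 \in unitmx, p.1 *m p.2 == c &
          ((n%:Z - (dimker1 p.1)%:Z - (dimker1 p.2)%:Z)%R == g%:Z)]]|.

(* |GL_g(F)| (= 1 for g = 0) *)
Definition cardGL (F : finFieldType) (g : nat) : nat :=
  #|[set A : 'M[F]_g | A \in unitmx]|.

Definition theta_bound (R : rcfType) (F : finFieldType) (n g : nat) : R :=
  Num.sqrt ((#|F|%:R : R) ^+ ((n + g) ^ 2)) / (cardGL F g)%:R.

(* Main.v *)
(* A pair (u, v) with u v = c is determined by u, and [\rank (v - 1) = \rank (u - c)],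
   so N_g(n) counts the u in GL_n with [\rank (u - 1) + \rank (u - c) = n + g].
   Put [\rank (u - 1) = n - a] and [\rank (u - c) = n - b], a + b = n - g.
   Weighting u by |GL_a| |GL_b| amounts to choosing bases X and Y of the row kernels of
   u - 1 and u - c, and triples (X, Y, u) with X u = X and Y u = Y c can be counted in
   the other order. As c - 1 is invertible, X and Y are independent, so at most
   q^(gn) matrices u are compatible with (X, Y); this gives the upper bound
   q^(n^2) / (|GL_a| |GL_b|) = O(q^(n^2 - a^2 - b^2)), whose sum over a is
   dominated by the balanced terms a ~ b ~ (n - g)/2. For the lower bound only balanced
   a and b are used: a positive proportion of the pairs (X, Y) has both [X; Y] and
   [X; Y c] of full rank, and for a positive proportion of the extensions u
   of such a pair u is invertible and the two kernels are no larger than prescribed.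
   Ellipticity of c enters only through the invertibility of c and c - 1. *)

Require Import Defs.
From HB Require Import structures.
From mathcomp Require Import all_boot all_order all_algebra all_fingroup all_field.
From mathcomp Require Import mxabelem zify ring lra.
Set Implicit Arguments. Unset Strict Implicit. Unset Printing Implicit Defensive.
Import Order.TTheory GRing.Theory Num.Theory.
Local Open Scope ring_scope.

(** * Products of the factors 1 - p^i *)

(* The proportion of m-tuples of rows that successively avoid the span of the previous
   ones and of k given independent rows, in dimension n = k + m + e, with p = 1/q. *)
Definition phi (R : realFieldType) (p : R) (e m : nat) : R :=
  \prod_(j < m) (1 - p ^+ (e + j).+1).

(** As p <= 1/2, the losses p^(e+1) + ... + p^(e+m) total at most p^e - p^(e+m); the induction
    carries the extra term p^(e+m). *)
Lemma phi_ge1B (R : realFieldType) (p : R) (e m : nat) :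
  0 <= p <= 2^-1 -> 1 - p ^+ e <= phi p e m.
Proof.
move=> /andP[p0 p2]; suff: 1 - p ^+ e + p ^+ (e + m) <= phi p e m.
  by apply: le_trans; rewrite lerDl exprn_ge0.
have pge k : 0 <= p ^+ k <= 1 by rewrite exprn_ge0 //= exprn_ile1 //; lra.
rewrite /phi; elim: m => [|m IHm]; first by rewrite big_ord0 addn0 subrK.
rewrite big_ord_recr /= addnS exprS.
have /andP[x0 x1] := pge (e + m)%N; have /andP[y0 y1] := pge e.
have xy : p ^+ (e + m) <= p ^+ e.
  by rewrite exprD ler_piMr //; have /andP[] := pge m.
apply: le_trans (ler_wpM2r _ IHm).
  have := mulr_ge0 (mulr_ge0 p0 x0) (_ : 0 <= p ^+ e - p ^+ (e + m)).
  by rewrite subr_ge0 => /(_ xy); nra.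
by have /andP[] := pge (e + m).+1; rewrite exprS; lra.
Qed.

Lemma phi_ge4 (R : realFieldType) (p : R) (e m : nat) :
  0 <= p <= 2^-1 -> 4^-1 <= phi p e m.
Proof.
move=> p02; have /andP[p0 p2] := p02; case: e => [|e].
  (* For e = 0 the previous bound is void, so the factor 1 - p is split off: (1 - p)^2 >= 1/4. *)
  case: m => [|m]; first by rewrite /phi big_ord0; lra.
  have -> : phi p 0 m.+1 = (1 - p) * phi p 1 m by rewrite /phi big_ord_recl.
  by have := phi_ge1B 1 m p02; rewrite expr1; nra.
apply: le_trans (phi_ge1B _ _ p02).
have : p ^+ e <= 1 by rewrite exprn_ile1 //; lra.
have : 0 <= p ^+ e by rewrite exprn_ge0.
by rewrite exprS; nra.
Qed.

Lemma invf_card_bounds (R : realFieldType) (F : finFieldType) :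
  0 <= (#|F|%:R : R)^-1 <= 2^-1.
Proof.
by rewrite invr_ge0 ler0n /= lef_pV2 ?ler_nat ?finNzRing_gt1 // posrE ltr0n
  // ltnW ?finNzRing_gt1.
Qed.

(** * Counting matrices whose rows are independent modulo given subspaces *)

Lemma card_pair_dep (T1 T2 : finType) (A : pred T1) (B : T1 -> pred T2) :
  #|[set x : T1 * T2 | A x.1 && B x.1 x.2]| = (\sum_(x | A x) #|[set y | B x y]|)%N.
Proof.
rewrite -sum1dep_card -(pair_big_dep A B (fun _ _ => 1%N)) /=.
by apply: eq_bigr => x _; rewrite sum1dep_card.
Qed.

(* [|U :|: U'| = 2 q^d - |U :&: U'|] and [\rank (U :&: U') >= 2 d - n]: the
   union bound alone would be useless for [q = 2]. *)
Lemma card_avoid_ge (R : realFieldType) (F : finFieldType) (n : nat) (U U' : 'M[F]_n) :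
  \rank U = \rank U' ->
  #|F|%:R ^+ n * (1 - #|F|%:R^-1 ^+ (n - \rank U)) ^+ 2
    <= #|[set x : 'rV[F]_n | ~~ (x <= U)%MS && ~~ (x <= U')%MS]|%:R :> R.
Proof.
move=> eqU; set S := [set x | _].
have -> : S = ~: (rowg U :|: rowg U').
  by apply/setP => x; rewrite !inE negb_or.
have := cardsC (rowg U :|: rowg U'); have := cardsUI (rowg U) (rowg U').
rewrite -rowgI !card_rowg card_mx mul1n -eqU.
set T := ~: _; set d := \rank U; set r := \rank (U :&: U').
have led : (d <= n)%N by rewrite rank_leq_row.
have ler : (d + d <= r + n)%N.
  rewrite {2}/d eqU -(mxrank_sum_cap U U') addnC leq_add2l.
  by rewrite rank_leq_row.
move=> /(congr1 (GRing.natmul (1 : R))) + /(congr1 (GRing.natmul (1 : R))).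
rewrite !natrD !natrX; set q : R := #|F|%:R.
have q1 : 1 <= q by rewrite /q ler1n ltnW // finNzRing_gt1.
have qu : q != 0 by rewrite gt_eqF // (lt_le_trans _ q1).
have -> : q ^+ n * (1 - q^-1 ^+ (n - d)) ^+ 2 = q ^+ n - q ^+ d - q ^+ d + q ^+ d * q^-1 ^+ (n - d).
  have -> : q ^+ d = q ^+ n * q^-1 ^+ (n - d).
    have -> : q ^+ n = q ^+ (n - d) * q ^+ d by rewrite -exprD subnK.
    by rewrite mulrAC exprVn divff ?mul1r // expf_neq0.
  by ring.
have : q ^+ d * q^-1 ^+ (n - d) <= q ^+ r.
  rewrite exprVn ler_pdivrMr ?exprn_gt0 ?(lt_le_trans _ q1) // -exprD.
  by rewrite ler_weXn2l //; lia.
lra.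
Qed.

Lemma rank_adds_row (F : fieldType) (n : nat) (U : 'M[F]_n) (x : 'rV[F]_n) :
  ~~ (x <= U)%MS -> \rank (U + x)%MS = (\rank U).+1.
Proof.
move=> xU; apply/eqP; rewrite eqn_leq; apply/andP; split.
  by rewrite (leq_trans (mxrank_adds_leqif _ _)) // -[X in (_ <= X)%N]addn1 leq_add2l rank_leq_row.
rewrite ltnNge; apply: contra xU.
by rewrite (geq_leqif (mxrank_leqif_sup (addsmxSl U x))) addsmx_sub => /andP[].
Qed.

(** The rows of [X] are independent modulo [U]. With [U] square, [(U + x)%MS] has the same type,
    which suits an induction adding one row at a time. *)
Definition extends (F : fieldType) (m n : nat) (U : 'M[F]_n) (X : 'M[F]_(m, n)) :=
  \rank (U + X)%MS == (\rank U + m)%N.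

Lemma extends_col (F : fieldType) (m n : nat) (U : 'M[F]_n) (x : 'rV[F]_n)
    (X : 'M[F]_(m, n)) :
  ~~ (x <= U)%MS -> extends (U + x)%MS X -> extends U (col_mx x X).
Proof.
move=> xU; rewrite /extends rank_adds_row // => /eqP eqr.
have -> : \rank (U + col_mx x X)%MS = \rank (U + x + X)%MS.
  by rewrite -addsmxA (adds_eqmx (eqmx_refl U) (addsmxE x X)).
by rewrite eqr add1n addnS.
Qed.

(** The first row must avoid [U] and [U'] at once, which accounts for the square of one factor of
    [phi]; both spaces then grow by that row and keep equal ranks. *)
Lemma card_extends_ge (R : realFieldType) (F : finFieldType) (e m n : nat) (U U' : 'M[F]_n) :
  \rank U = \rank U' -> (\rank U + m + e = n)%N ->
  #|F|%:R ^+ (m * n) * phi #|F|%:R^-1 e m ^+ 2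
    <= #|[set X : 'M[F]_(m, n) | extends U X && extends U' X]|%:R :> R.
Proof.
elim: m U U' => [|m IHm] U U' eqU dimU.
  rewrite mul0n expr0 /phi big_ord0 expr1n mulr1 ler1n card_gt0.
  apply/set0Pn; exists 0; rewrite inE /extends !addn0.
  by rewrite !addsmx0 !eqxx.
set S := [set x : 'rV[F]_n | ~~ (x <= U)%MS && ~~ (x <= U')%MS].
pose T (x : 'rV[F]_n) := [set X : 'M[F]_(m, n) | extends (U + x)%MS X && extends (U' + x)%MS X].
have le_card : (\sum_(x in S) #|T x|
    <= #|[set X : 'M[F]_(m.+1, n) | extends U X && extends U' X]|)%N.
  have := card_pair_dep (mem S) (fun x => mem (T x)).
  under eq_bigr => x _ do rewrite cardsE.
  move=> <-.
  rewrite -(card_imset _ (f := fun p : 'rV[F]_n * 'M[F]_(m, n) => col_mx p.1 p.2 : 'M_(m.+1, n))).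
    apply/subset_leq_card/subsetP => _ /imsetP[[x X] + ->].
    rewrite !inE /= => /andP[/andP[xU xU'] /andP[XU XU']].
    by rewrite !extends_col.
  by move=> [x X] [y Y] /= /(@eq_col_mx F 1 m n)[-> ->].
move: le_card; rewrite -(ler_nat R) => /(le_trans _); apply.
have := card_avoid_ge R eqU; rewrite -/S.
have -> : (n - \rank U)%N = (e + m).+1 by lia.
pose B : R := #|F|%:R ^+ (m * n) * phi #|F|%:R^-1 e m ^+ 2.
have B0 : 0 <= B by rewrite mulr_ge0 ?sqr_ge0 // exprn_ge0.
move=> /(ler_wpM2r B0) le_S.
apply: (@le_trans _ _ (#|S|%:R * B : R)).
  rewrite mulSn exprD {1}/phi big_ord_recr /= -/(phi _ e m).
  by apply: le_trans le_S; rewrite le_eqVlt; apply/orP; left; apply/eqP; rewrite /B; ring.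
rewrite natr_sum mulr_natl -sumr_const; apply: ler_sum => x.
rewrite inE => /andP[xU xU']; apply: IHm; rewrite !rank_adds_row ?eqU //; lia.
Qed.

Lemma extends_gen (F : fieldType) (k m n : nat) (Z : 'M[F]_(k, n)) (X : 'M[F]_(m, n)) :
  row_free Z -> extends <<Z>>%MS X = row_free (col_mx Z X).
Proof.
move=> /eqP rZ; rewrite /extends /row_free !(adds_eqmx (genmxE Z) (eqmx_refl X)).
by rewrite addsmxE genmxE rZ.
Qed.

Lemma card_row_free_col_ge (R : realFieldType) (F : finFieldType) (e k m n : nat)
    (Z Z' : 'M[F]_(k, n)) :
  row_free Z -> row_free Z' -> (k + m + e = n)%N ->
  #|F|%:R ^+ (m * n) * phi #|F|%:R^-1 e m ^+ 2
    <= #|[set X : 'M[F]_(m, n) | row_free (col_mx Z X) && row_free (col_mx Z' X)]|%:R :> R.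
Proof.
move=> fZ fZ' dim; have rZ := eqP fZ; have rZ' := eqP fZ'.
under eq_finset => X do rewrite -!extends_gen //.
by apply: card_extends_ge; rewrite !genmxE ?rZ ?rZ'.
Qed.

Lemma card_row_free_ge (R : realFieldType) (F : finFieldType) (m n : nat) :
  (m <= n)%N ->
  #|F|%:R ^+ (m * n) / 16 <= #|[set X : 'M[F]_(m, n) | row_free X]|%:R :> R.
Proof.
move=> mn; have := @card_extends_ge R F (n - m) m n 0 0 erefl.
rewrite mxrank0 add0n subnKC // => /(_ erefl) le_card.
have -> : [set X : 'M[F]_(m, n) | row_free X] = [set X | extends 0 X && extends 0 X].
  apply/setP => X; rewrite !inE andbb /extends /row_free mxrank0 add0n.
  by rewrite (adds0mx _ X).
apply: le_trans le_card; rewrite ler_wpM2l ?exprn_ge0 //.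
by have := phi_ge4 (n - m) m (invf_card_bounds R F); nra.
Qed.

Lemma card_not_row_free_col_le (R : realFieldType) (F : finFieldType) (e k m n : nat)
    (Z : 'M[F]_(k, n)) :
  row_free Z -> (k + m + e = n)%N ->
  #|[set X : 'M[F]_(m, n) | ~~ row_free (col_mx Z X)]|%:R
    <= #|F|%:R ^+ (m * n) * (2 * #|F|%:R^-1 ^+ e) :> R.
Proof.
move=> fZ dim; have := card_row_free_col_ge R fZ fZ dim.
under eq_finset => X do rewrite andbb.
have := cardsC [set X : 'M[F]_(m, n) | row_free (col_mx Z X)].
rewrite card_mx => /(congr1 (GRing.natmul (1 : R))); rewrite natrD natrX.
have -> : ~: [set X | row_free (col_mx Z X)] = [set X : 'M[F]_(m, n) | ~~ row_free (col_mx Z X)].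
  by apply/setP => X; rewrite !inE.
set x : R := #|_|%:R; set y : R := #|_|%:R; set Q := #|F|%:R ^+ _ => eqQ.
have Q0 : 0 <= Q by rewrite exprn_ge0.
have /andP[p0 p2] := invf_card_bounds R F.
have := phi_ge1B e m (invf_card_bounds R F).
set f := phi _ _ _; set P := _ ^+ e => le_f le_x.
have P0 : 0 <= P by rewrite exprn_ge0.
have P1 : P <= 1 by rewrite exprn_ile1 //; lra.
have : 1 - 2 * P <= f ^+ 2 by nra.
by move=> /(ler_wpM2l Q0); lra.
Qed.

(** * Orders of general linear groups and double counting of kernel bases *)

Lemma cardGL_ge (R : realFieldType) (F : finFieldType) (n : nat) :
  #|F|%:R ^+ (n * n) / 16 <= (cardGL F n)%:R :> R.
Proof.
rewrite /cardGL; under eq_finset => X do rewrite -row_free_unit.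
exact: card_row_free_ge.
Qed.

Lemma cardGL_le (F : finFieldType) (n : nat) : (cardGL F n <= #|F| ^ (n * n))%N.
Proof. by rewrite -card_mx max_card. Qed.

Lemma cardGL_gt0 (F : finFieldType) (n : nat) : (0 < cardGL F n)%N.
Proof. by apply/card_gt0P; exists 1%:M; rewrite inE unitmx1. Qed.

(** For a fixed basis K of the row kernel, these X are exactly the P K with P in GL_a. *)
Lemma card_row_free_ker (F : finFieldType) (a n p : nat) (M : 'M[F]_(n, p)) :
  (\rank M + a = n)%N ->
  #|[set X : 'M[F]_(a, n) | row_free X && (X *m M == 0)]| = cardGL F a.
Proof.
move=> dimM; have [K fK eqK] : exists2 K : 'M[F]_(a, n), row_free K & (K :=: kermx M)%MS.
  have <- : \rank (kermx M) = a by rewrite mxrank_ker; lia.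
  by exists (row_base (kermx M)); [apply: row_base_free | apply: eq_row_base].
rewrite /cardGL -(card_imset _ (row_free_inj fK)); congr #|pred_of_set _|.
apply/setP => X; rewrite !inE; apply/andP/imsetP => [[fX /eqP XM]|[P]].
  have /submxP[D eqX] : (X <= K)%MS by rewrite eqK; apply/sub_kermxP.
  exists D => //; rewrite inE -row_free_unit /row_free -(mxrankMfree D fK) -eqX.
  exact: fX.
rewrite inE -row_free_unit => fP ->; split.
  by rewrite /row_free mxrankMfree.
by rewrite -mulmxA (_ : K *m M = 0) ?mulmx0 //; apply/sub_kermxP; rewrite eqK.
Qed.

Lemma row_free_of_ker (F : fieldType) (m n : nat) (M : 'M[F]_(m, n)) :
  (forall v : 'rV_m, v *m M = 0 -> v = 0) -> row_free M.
Proof.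
by move=> M0; rewrite -kermx_eq0; apply/rowV0P => v /sub_kermxP; apply: M0.
Qed.

Lemma exists_complement (F : fieldType) (k g n : nat) (M : 'M[F]_(k, n)) :
  row_free M -> (k + g = n)%N -> exists Z : 'M[F]_(g, n), row_free (col_mx M Z).
Proof.
move=> /eqP rM dim; have <- : \rank (M^C)%MS = g by rewrite mxrank_compl; lia.
exists (row_base M^C)%MS; rewrite /row_free -addsmxE.
rewrite (adds_eqmx (eqmx_refl M) (eq_row_base _)).
by have /eqP -> := addsmx_compl_full M; rewrite mxrank_compl; lia.
Qed.

(** [S] and [T] stay abstract because the upper and the lower bound use u - 1 and u - c in opposite
    orders. *)
Lemma card_times_GL (F : finFieldType) (a b n : nat) (S T : 'M[F]_n -> 'M[F]_n)
    (D : {set 'M[F]_n}) :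
  (forall u, u \in D -> (\rank (S u) + a = n)%N /\ (\rank (T u) + b = n)%N) ->
  (#|D| * (cardGL F a * cardGL F b) =
   \sum_(z : 'M[F]_(a, n) * 'M[F]_(b, n) | row_free z.1 && row_free z.2)
      #|[set u in D | (z.1 *m S u == 0)%R && (z.2 *m T u == 0)%R]|)%N.
Proof.
move=> rD; under [RHS]eq_bigr => z _ do rewrite -sum1dep_card.
rewrite (exchange_big_dep (mem D)) /=; last by move=> z u _ /andP[].
rewrite -sum_nat_const; apply: eq_bigr => u uD; have [rS rT] := rD u uD.
rewrite sum1dep_card -(card_row_free_ker rS) -(card_row_free_ker rT) -cardsX.
apply: eq_card => -[X Y]; rewrite !inE /= uD /=.
by rewrite andbACA.
Qed.

(** * Upper bound for prescribed ranks *)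

(** Applying u to s X + t Y = 0 gives s X + t Y c = 0; subtracting, t Y (c - 1) = 0, so t = 0 and
    then s = 0. *)
Lemma row_free_col_fix (F : fieldType) (a b n : nat) (c u : 'M[F]_n)
    (X : 'M[F]_(a, n)) (Y : 'M[F]_(b, n)) :
  c - 1%:M \in unitmx -> row_free X -> row_free Y ->
  X *m (u - 1%:M) = 0 -> Y *m (u - c) = 0 -> row_free (col_mx X Y).
Proof.
move=> c1 fX fY; rewrite !mulmxBr mulmx1 => /subr0_eq Xu /subr0_eq Yu.
apply: row_free_of_ker => v; rewrite -[v]hsubmxK mul_row_col.
set s := lsubmx v; set t := rsubmx v => st0.
have : (s *m X + t *m Y) *m u - (s *m X + t *m Y) = 0 by rewrite st0 mul0mx subr0.
rewrite mulmxDl -!mulmxA Xu Yu opprD addrACA subrr add0r => tY.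
have t0 : t = 0.
  apply: (row_free_inj fY); apply: (row_free_inj (_ : row_free (c - 1%:M))).
    by rewrite row_free_unit.
  by rewrite !mul0mx mulmxBr mulmx1 -mulmxA.
move: st0; rewrite t0 mul0mx addr0 => sX.
by rewrite (row_free_inj fX (etrans sX (esym (mul0mx _ _)))) row_mx0.
Qed.

(** If some compatible u0 exists, X and Y are independent and have a complement Z of g rows. Since X
    u and Y u are prescribed, Z u determines u. *)
Lemma card_fix_le (F : finFieldType) (a b g n : nat) (c : 'M[F]_n)
    (X : 'M[F]_(a, n)) (Y : 'M[F]_(b, n)) (D : {set 'M[F]_n}) :
  (a + b + g = n)%N -> c - 1%:M \in unitmx -> row_free X -> row_free Y ->
  (#|[set u in D | (X *m (u - 1%:M) == 0)%R && (Y *m (u - c) == 0)%R]| <= #|F| ^ (g * n))%N.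
Proof.
move=> dim c1 fX fY; set S := [set u in D | _].
have [->|[u0]] := set_0Vmem S; first by rewrite cards0.
rewrite inE => /and3P[_ /eqP Xu0 /eqP Yu0].
have fXY := row_free_col_fix c1 fX fY Xu0 Yu0.
have [Z fZ] := exists_complement fXY dim.
rewrite -card_mx -(card_in_imset (f := fun u : 'M[F]_n => Z *m u)) ?max_card // => u u'.
rewrite !inE => /and3P[_ /eqP + /eqP +] /and3P[_ /eqP + /eqP +] Zu.
rewrite !mulmxBr !mulmx1.
move=> /subr0_eq Xu /subr0_eq Yu /subr0_eq Xu' /subr0_eq Yu'.
have /row_fullP[B BXYZ] : row_full (col_mx (col_mx X Y) Z) by rewrite /row_full (eqP fZ) dim.
by rewrite -[u]mul1mx -[u']mul1mx -BXYZ -!mulmxA !mul_col_mx Xu Xu' Yu Yu' Zu.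
Qed.

Lemma card_genus_le (F : finFieldType) (a b g n : nat) (c : 'M[F]_n) :
  (a + b + g = n)%N -> c - 1%:M \in unitmx ->
  (#|[set u : 'M[F]_n | (\rank (u - 1%:M)%R == b + g) && (\rank (u - c)%R == a + g)]|
     * (cardGL F a * cardGL F b) <= #|F| ^ (n * n))%N.
Proof.
move=> dim c1; rewrite (card_times_GL (S := fun u => u - 1%:M) (T := fun u => u - c)).
  apply: (@leq_trans (\sum_(z : 'M[F]_(a, n) * 'M[F]_(b, n)) #|F| ^ (g * n))).
    rewrite [leqRHS](bigID (fun z => row_free z.1 && row_free z.2)) /=.
    apply: leq_trans (leq_addr _ _); apply: leq_sum => z /andP[f1 f2].
    exact: card_fix_le.
  by rewrite sum_nat_const card_prod !card_mx -!expnD -!mulnDl dim.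
by move=> u; rewrite inE => /andP[/eqP -> /eqP ->]; split; lia.
Qed.

(** * Lower bound for prescribed ranks *)

Lemma rank_col_mx0 (F : fieldType) (m k l n : nat) (P : 'M[F]_(m, n)) (Q : 'M[F]_(k, n)) :
  \rank (col_mx (col_mx P (0 : 'M_(l, n))) Q) = \rank (col_mx P Q).
Proof.
rewrite -!addsmxE -(adds_eqmx (addsmxE P (0 : 'M_(l, n))) (eqmx_refl Q)).
by rewrite (adds_eqmx (addsmx0 _ P) (eqmx_refl Q)).
Qed.

Lemma rank_col_0mx (F : fieldType) (m k l n : nat) (P : 'M[F]_(m, n)) (Q : 'M[F]_(k, n)) :
  \rank (col_mx (col_mx (0 : 'M_(l, n)) P) Q) = \rank (col_mx P Q).
Proof.
rewrite -!addsmxE -(adds_eqmx (addsmxE (0 : 'M_(l, n)) P) (eqmx_refl Q)).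
by rewrite (adds_eqmx (adds0mx _ P) (eqmx_refl Q)).
Qed.

Lemma row_free_col (F : fieldType) (a b n : nat) (Y : 'M[F]_(a, n)) (X : 'M[F]_(b, n)) :
  row_free (col_mx Y X) -> row_free Y && row_free X.
Proof.
move=> fYX; have inj0 v w : v *m Y + w *m X = 0 -> row_mx v w = 0 :> 'rV_(a + b).
  by rewrite -mul_row_col => vw; apply: (row_free_inj fYX); rewrite vw mul0mx.
apply/andP; split; apply: row_free_of_ker => v v0.
  have : row_mx v 0 = 0 :> 'rV_(a + b) by apply: inj0; rewrite v0 mul0mx addr0.
  by rewrite -row_mx0 => /eq_row_mx[].
have : row_mx 0 v = 0 :> 'rV_(a + b) by apply: inj0; rewrite v0 mul0mx add0r.
by rewrite -row_mx0 => /eq_row_mx[].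
Qed.

Lemma card_not_row_free_shift_le (R : realFieldType) (F : finFieldType) (g k n : nat)
    (P : 'M[F]_(k, n)) (Z : 'M[F]_(g, n)) :
  row_free P -> (k + g + 7 <= n)%N ->
  #|[set W : 'M[F]_(g, n) | ~~ row_free (col_mx P (W - Z))]|%:R
    <= #|F|%:R ^+ (g * n) / 64 :> R.
Proof.
move=> fP kg.
have -> : #|[set W : 'M[F]_(g, n) | ~~ row_free (col_mx P (W - Z))]|
    = #|[set W : 'M[F]_(g, n) | ~~ row_free (col_mx P W)]|.
  rewrite -[RHS](card_imset _ (addIr Z)); apply: eq_card => W; rewrite inE.
  apply/idP/imsetP => [fW|[W']]; last by rewrite inE => fW' ->; rewrite addrK in fW' *.
  by exists (W - Z); rewrite ?inE ?subrK.
have dim : (k + g + (n - (k + g)) = n)%N by lia.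
have e7 : (7 <= n - (k + g))%N by lia.
apply: le_trans (card_not_row_free_col_le R fP dim) _.
rewrite ler_wpM2l ?exprn_ge0 //; have /andP[p0 p2] := invf_card_bounds R F.
(* The margin 7 is chosen so that 2 / 2^7 = 1/64, small enough for two such losses to fit into
   1/16. *)
apply: (@le_trans _ _ (2 * 2^-1 ^+ 7)); last by rewrite !exprS expr0; lra.
rewrite ler_wpM2l //; apply: (@le_trans _ _ (#|F|%:R^-1 ^+ 7)).
  by apply: ler_wiXn2l => //; lra.
by rewrite lerXn2r ?nnegrE // invr_ge0.
Qed.

Lemma remaining_ge (R : realFieldType) (x A G B C : R) :
  x / 16 <= A -> A <= G + B + C -> B <= x / 64 -> C <= x / 64 -> x / 32 <= G.
Proof. lra. Qed.

(** Let u send the basis [Y; X; Z] to [Y c; X; W]. Then u - c sends it to [0; X (1 - c); W - Z c]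
    and u - 1 sends it to [Y (c - 1); 0; W - Z]. All requirements on u thus become independence
    conditions on W: the first holds for a proportion of at least 1/16, and each of the other two
    fails for at most 1/64. *)
Lemma card_fix_ge (R : realFieldType) (F : finFieldType) (a b g n : nat) (c : 'M[F]_n)
    (Y : 'M[F]_(a, n)) (X : 'M[F]_(b, n)) :
  (a + b + g = n)%N -> (7 <= a)%N -> (7 <= b)%N ->
  c \in unitmx -> c - 1%:M \in unitmx ->
  row_free (col_mx Y X) -> row_free (col_mx (Y *m c) X) ->
  #|F|%:R ^+ (g * n) / 32 <=
  #|[set u in [set u : 'M[F]_n | [&& u \in unitmx, \rank (u - c)%R == b + g
                                  & \rank (u - 1%:M)%R == a + g]%N]
       | (Y *m (u - c) == 0) && (X *m (u - 1%:M) == 0)]|%:R :> R.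
Proof.
move=> dim a7 b7 cu c1 fYX fYcX.
have dimY : (a + g + 7 <= n)%N by lia.
have dimX : (b + g + 7 <= n)%N by lia.
have /andP[fY fX] := row_free_col fYX.
have [Z fZ] := exists_complement fYX dim.
have fY1 : row_free (Y *m (c - 1%:M)).
  by rewrite /row_free mxrankMfree // row_free_unit.
have fX1 : row_free (X *m (1%:M - c)).
  by rewrite -opprB mulmxN /row_free mxrank_opp mxrankMfree // row_free_unit.
pose A := [set W : 'M[F]_(g, n) | row_free (col_mx (col_mx (Y *m c) X) W)].
pose B (k : nat) (P : 'M[F]_(k, n)) (Z' : 'M[F]_(g, n)) :=
  [set W : 'M[F]_(g, n) | ~~ row_free (col_mx P (W - Z'))].
have card_A : #|F|%:R ^+ (g * n) / 16 <= #|A|%:R :> R.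
  have := @card_row_free_col_ge R F 0 _ g n _ _ fYcX fYcX.
  under eq_finset => W do rewrite andbb.
  rewrite addn0 => /(_ dim); apply: le_trans; rewrite ler_wpM2l ?exprn_ge0 //.
  by have := phi_ge4 0 g (invf_card_bounds R F); nra.
pose G := A :\: (B a (Y *m (c - 1%:M)) Z :|: B b (X *m (1%:M - c)) (Z *m c)).
have card_G : #|F|%:R ^+ (g * n) / 32 <= #|G|%:R :> R.
  apply: remaining_ge card_A _ (card_not_row_free_shift_le R Z fY1 dimY)
    (card_not_row_free_shift_le R (Z *m c) fX1 dimX).
  rewrite -!natrD ler_nat -addnA.
  have AG : A \subset G :|: (B a (Y *m (c - 1%:M)) Z :|: B b (X *m (1%:M - c)) (Z *m c)).
    by apply/subsetP => W WA; rewrite in_setU in_setD WA andbT orNb.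
  apply: leq_trans (subset_leq_card AG) (leq_trans (leq_card_setU _ _) _).
  by rewrite leq_add2l leq_card_setU.
apply: le_trans card_G _; rewrite ler_nat.
have [M MYXZ] : exists M, M *m col_mx (col_mx Y X) Z = 1%:M.
  by apply/row_fullP; rewrite /row_full (eqP fZ) dim.
have full_YXZ : row_full (col_mx (col_mx Y X) Z) by rewrite /row_full (eqP fZ) dim.
have mulK (W : 'M[F]_(a + b + g, n)) : col_mx (col_mx Y X) Z *m (M *m W) = W.
  rewrite mulmxA; suff -> : col_mx (col_mx Y X) Z *m M = 1%:M by rewrite mul1mx.
  by apply: (row_free_inj fZ); rewrite -mulmxA MYXZ mulmx1 mul1mx.
pose f (W : 'M[F]_(g, n)) := M *m col_mx (col_mx (Y *m c) X) W.
have fE W : [/\ Y *m f W = Y *m c, X *m f W = X & Z *m f W = W].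
  have := mulK (col_mx (col_mx (Y *m c) X) W).
  by rewrite -/(f W) !mul_col_mx => /eq_col_mx[/eq_col_mx[-> ->] ->].
rewrite -(card_imset _ (f := f)); last first.
  by move=> W W' eqW; have [_ _ <-] := fE W; rewrite eqW; have [_ _ ->] := fE W'.
apply/subset_leq_card/subsetP => _ /imsetP[W + ->].
rewrite !inE negb_or !negbK => /andP[/andP[fYW fXW] fW].
have [EY EX EZ] := fE W.
have rankE (N : 'M[F]_n) : \rank N = \rank (col_mx (col_mx Y X) Z *m N).
  by rewrite (eqmxMfull N full_YXZ).
apply/andP; split; last by rewrite !mulmxBr mulmx1 EY EX !subrr !eqxx.
rewrite -row_free_unit /row_free !(rankE (_ - _)) rankE !mul_col_mx !mulmxBr !mulmx1.
rewrite EY EX EZ !subrr rank_col_mx0 rank_col_0mx (eqP fW) dim eqxx /=.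
move: fYW fXW; rewrite /row_free !mulmxBr !mulmx1 => -> ->.
by [].
Qed.

(** The factor 256 = 16 * 16 pays for choosing Y and then X independent of both Y and Y c; the
    factor 32 pays for the extension u. *)
Lemma card_genus_ge (R : realFieldType) (F : finFieldType) (a b g n : nat) (c : 'M[F]_n) :
  (a + b + g = n)%N -> (7 <= a)%N -> (7 <= b)%N ->
  c \in unitmx -> c - 1%:M \in unitmx ->
  #|F|%:R ^+ (n * n) / 256 / 32 <=
  #|[set u : 'M[F]_n | [&& u \in unitmx, \rank (u - c)%R == b + g
                         & \rank (u - 1%:M)%R == a + g]%N]|%:R
    * (cardGL F a * cardGL F b)%:R :> R.
Proof.
move=> dim a7 b7 cu c1; set D := [set u | _].
rewrite -natrM (card_times_GL (S := fun u => u - c) (T := fun u => u - 1%:M)); last first.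
  by move=> u; rewrite inE => /and3P[_ /eqP -> /eqP ->]; split; lia.
pose P (Y : 'M[F]_(a, n)) :=
  [set X : 'M[F]_(b, n) | row_free (col_mx Y X) && row_free (col_mx (Y *m c) X)].
have card_P Y : row_free Y -> #|F|%:R ^+ (b * n) / 16 <= #|P Y|%:R :> R.
  move=> fY; have fYc : row_free (Y *m c) by rewrite /row_free mxrankMfree ?row_free_unit.
  have dim' : (a + b + g)%N = n by [].
  apply: le_trans (card_row_free_col_ge R fY fYc dim'); rewrite ler_wpM2l ?exprn_ge0 //.
  by have := phi_ge4 g b (invf_card_bounds R F); nra.
pose A := [set z : 'M[F]_(a, n) * 'M[F]_(b, n) | row_free z.1 && (z.2 \in P z.1)].
have card_A : #|F|%:R ^+ (a * n) / 16 * (#|F|%:R ^+ (b * n) / 16) <= #|A|%:R :> R.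
  rewrite (card_pair_dep (fun Y => row_free Y) (fun Y => mem (P Y))) natr_sum.
  apply: (@le_trans _ _ (\sum_(Y : 'M[F]_(a, n) | row_free Y) #|F|%:R ^+ (b * n) / 16)).
    rewrite sumr_const -[leRHS]mulr_natl ler_wpM2r ?divr_ge0 ?exprn_ge0 //.
    by apply: le_trans (card_row_free_ge R F _) _; [lia | rewrite cardsE].
  by apply: ler_sum => Y fY; rewrite cardsE; apply: card_P.
apply: (@le_trans _ _ (#|A|%:R * (#|F|%:R ^+ (g * n) / 32))).
  have -> : (n * n = a * n + b * n + g * n)%N by rewrite -!mulnDl dim.
  rewrite !exprD.
  have G0 : 0 <= #|F|%:R ^+ (g * n) / 32 :> R by rewrite divr_ge0 ?exprn_ge0.
  by have := ler_wpM2r G0 card_A; lra.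
rewrite mulr_natl -sumr_const natr_sum.
(* Pairs outside [A] contribute nonnegative terms and are dropped. *)
rewrite [leRHS](bigID (mem A)) /=.
apply: ler_wpDr; first exact: sumr_ge0.
rewrite [leRHS](eq_bigl (mem A)); last first.
  move=> [Y X] /=; rewrite inE /= inE; case fYX: (row_free (col_mx Y X)); last by rewrite !andbF.
  by have /andP[-> ->] := row_free_col fYX.
apply: ler_sum => -[Y X]; rewrite !inE /= => /and3P[_ fYX fYcX].
exact: card_fix_ge.
Qed.

(** * Invertibility of c and c - 1 *)

(** A vector killed by the transpose of c - x gives the coordinates of some t in L with (s - x) t =
    0; L is a field, so t = 0. The transpose reflects the column convention. *)
Lemma regular_elliptic_unitB (F : finFieldType) (n : nat) (c : 'M[F]_n)
    (L : fieldExtType F) (s : L) (b : n.-tuple L) (x : F) :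
  basis_of fullv b -> s != x%:A ->
  (forall j : 'I_n, s * b`_j = \sum_(i < n) c i j *: b`_i) ->
  c - x%:M \in unitmx.
Proof.
move=> /andP[_ /freeP fb] sx sb; rewrite -unitmx_tr -row_free_unit.
apply: row_free_of_ker => w w0.
pose t := \sum_(j < n) w 0 j *: b`_j.
have : (s - x%:A) * t = \sum_(i < n) (w *m (c - x%:M)^T) 0 i *: b`_i.
  rewrite /t mulr_sumr.
  under [RHS]eq_bigr => i _ do rewrite mxE scaler_suml.
  rewrite exchange_big /=; apply: eq_bigr => j _.
  rewrite -scalerAr mulrBl sb mulr_algl.
  under [RHS]eq_bigr => i _ do rewrite !mxE -scalerA scalerBl.
  rewrite -scaler_sumr sumrB; congr (_ *: (_ - _)).
  rewrite (bigD1 j) //= eqxx mulr1n big1 ?addr0 // => i ij.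
  by rewrite (negPf ij) mulr0n scale0r.
under eq_bigr => i _ do rewrite w0 mxE scale0r.
rewrite sumr_const mul0rn => /eqP; rewrite mulf_eq0 subr_eq0 (negPf sx) /= => /eqP t0.
by apply/rowP => j; rewrite mxE (fb _ t0).
Qed.

Lemma regular_elliptic_units (F : finFieldType) (n : nat) (c : 'M[F]_n) :
  regular_elliptic c -> (c \in unitmx) && (c - 1%:M \in unitmx).
Proof.
move=> [L [s [b [bb gs s0 s1 sb]]]]; apply/andP; split.
  have := regular_elliptic_unitB bb (x := 0) _ sb.
  by rewrite scale0r raddf0 subr0; apply.
apply: (regular_elliptic_unitB bb _ sb); rewrite scale1r.
have [n1|n1] := eqVneq n 1%N; first by move: s1; rewrite n1.
(* If s = 1, then F[s] = F, so L has dimension n = 1. *)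
apply: contra n1 => /eqP s_1; have := size_basis bb.
rewrite -gs s_1 => <-; have /Fadjoin_idP -> : (1 : L) \in 1%AS by rewrite mem1v.
by rewrite dimv1.
Qed.

(** * Reduction of the genus count to ranks *)

Lemma genus_eq_rank (n g r1 r2 : nat) :
  (r1 <= n)%N -> (r2 <= n)%N ->
  (n%:Z - (n - r1)%N%:Z - (n - r2)%N%:Z == g%:Z) = (r1 + r2 == n + g)%N.
Proof. by move=> *; apply/eqP/eqP; lia. Qed.

Lemma Ngenus_eq (F : finFieldType) (n g : nat) (c : 'M[F]_n) :
  c \in unitmx ->
  Ngenus g c = #|[set u : 'M[F]_n |
    (u \in unitmx) && (\rank (u - 1%:M)%R + \rank (u - c)%R == n + g)%N]|.
Proof.
move=> cu; rewrite /Ngenus; set S := [set p | _].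
have S_rank p : p \in S -> p.1 \in unitmx /\ (\rank (p.1 - 1%:M)%R + \rank (p.1 - c)%R == n + g)%N.
  rewrite inE => /and4P[p1 p2 /eqP p12].
  rewrite /dimker1 !mxrank_ker genus_eq_rank ?rank_leq_row // => rp; split=> //.
  (* With c = u v one has u - c = u (1 - v), and u is invertible. *)
  have -> : \rank (p.1 - c) = \rank (p.2 - 1%:M).
    rewrite -p12 -{1}[p.1]mulmx1 -mulmxBr -opprB mulmxN mxrank_opp.
    by rewrite (eqmxMfull _ (_ : row_full p.1)) // row_full_unit.
  exact: rp.
rewrite -(card_in_imset (f := fst) (D := S)); last first.
  move=> [u v] [u' v']; rewrite !inE /= => /and4P[uu _ /eqP uv _] /and4P[_ _ /eqP uv' _] uu'.
  by congr pair => //; rewrite -uu' in uv'; rewrite -[v](mulKmx uu) uv -uv' mulKmx.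
apply: eq_card => u; rewrite inE; apply/imsetP/andP => [[p pS ->]|[uu ru]].
  by apply: S_rank.
exists (u, invmx u *m c) => //; rewrite inE /= unitmx_mul unitmx_inv uu cu mulKVmx // eqxx /=.
rewrite /dimker1 !mxrank_ker genus_eq_rank ?rank_leq_row //.
have -> : \rank (invmx u *m c - 1%:M) = \rank (u - c).
  rewrite -(mulVmx uu) -mulmxBr -opprB mulmxN mxrank_opp.
  by rewrite (eqmxMfull _ (_ : row_full (invmx u))) // row_full_unit unitmx_inv.
exact: ru.
Qed.

Lemma Ngenus_le_sum (F : finFieldType) (n g : nat) (c : 'M[F]_n) :
  c \in unitmx -> (g <= n)%N ->
  (Ngenus g c <= \sum_(a < (n - g).+1)
     #|[set u : 'M[F]_n | (\rank (u - 1%:M)%R == (n - g - a) + g) && (\rank (u - c)%R == a + g)]|)%N.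
Proof.
move=> cu gn; rewrite (Ngenus_eq _ cu) -sum1_card.
(* As \rank (u - c) <= n, the rank of u - 1 is at least g, so [inord] stays in range and never
   returns its default. *)
rewrite (partition_big (fun u : 'M[F]_n => inord (n - \rank (u - 1%:M)) : 'I_(n - g).+1) predT) //=.
apply: leq_sum => a _; rewrite sum1dep_card; apply/subset_leq_card/subsetP => u.
rewrite !inE => /andP[/andP[_ ru] /eqP/(congr1 val) /=].
move: (rank_leq_row (u - 1%:M)) (rank_leq_row (u - c)) ru (ltn_ord a).
move: (\rank _) (\rank _) => r1 r2 r1n r2n /eqP r12 aN.
by rewrite inordK; lia.
Qed.

(** * Summation over the kernel dimensions and comparison of exponents *)

(** Truncated subtraction makes the exponent |a - k|, so two geometric series are summed. Shifting
    the centre k by induction requires the sharper bound 4 - 2 p^k. *)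
Lemma sum_expr_dist_le4 (R : realFieldType) (p : R) (k N : nat) :
  0 <= p <= 2^-1 -> \sum_(a < N) p ^+ ((a - k) + (k - a)) <= 4.
Proof.
move=> /andP[p0 p2]; suff: \sum_(a < N) p ^+ ((a - k) + (k - a)) <= 4 - 2 * p ^+ k.
  by move/le_trans; apply; rewrite gerBl mulr_ge0 // exprn_ge0.
elim: k N => [|k IHk] [|N]; rewrite ?big_ord0.
- by rewrite expr0; lra.
- suff: \sum_(a < N.+1) p ^+ a <= 2.
    move=> le2; rewrite expr0; under eq_bigr => a _ do rewrite subn0 sub0n addn0.
    by lra.
  elim: N => [|N IHN]; first by rewrite big_ord1 expr0; lra.
  rewrite big_ord_recl /= expr0; under eq_bigr => a _ do rewrite /bump add1n exprS.
  by rewrite -mulr_sumr; nra.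
- have : p ^+ k.+1 <= 1 by rewrite exprn_ile1 //; lra.
  by lra.
rewrite big_ord_recl /= sub0n subn0 add0n.
under eq_bigr => a _ do rewrite /bump add1n !subSS.
have := IHk N; have : 0 <= p ^+ k by rewrite exprn_ge0.
by rewrite exprS; nra.
Qed.

Lemma half_split (m : nat) :
  exists d : nat, (d <= 1)%N /\ (m./2 + (m./2 + d) = m)%N.
Proof. by exists (odd m); split; [case: odd | rewrite -{4}(odd_double_half m); lia]. Qed.

(* (n + g)^2 + 2 (a^2 + b^2) = 2 (n^2 + g^2) + (b - a)^2 with b = a + d. *)
Lemma sqrt_weight_bounds (R : rcfType) (q : R) (n g a d : nat) :
  1 <= q -> (d <= 1)%N -> (a + (a + d) + g = n)%N ->
  q ^+ (n * n + g * g) <=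
    Num.sqrt (q ^+ ((n + g) ^ 2)) * q ^+ (a * a + (a + d) * (a + d))
  <= q ^+ (n * n + g * g).+1.
Proof.
move=> q1 d1 dim; have q0 : 0 <= q by lra.
set T := Num.sqrt _; set S := (a * a + _)%N; set N := (n * n + g * g)%N.
have TS0 : 0 <= T * q ^+ S by rewrite mulr_ge0 ?sqrtr_ge0 ?exprn_ge0.
have TS : (T * q ^+ S) ^+ 2 = q ^+ ((n + g) ^ 2 + S * 2).
  by rewrite exprMn sqr_sqrtr ?exprn_ge0 // -exprM -exprD.
have E : ((n + g) ^ 2 + S * 2 = N * 2 + d)%N.
  by rewrite /S /N -mulnn; move: d1 dim; clear; case: d => [|[|d]] // _ <-; rewrite ?addn0; lia.
apply/andP; split; rewrite -(ler_pXn2r (n := 2)) ?nnegrE ?exprn_ge0 // TS E -exprM.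
  by rewrite ler_weXn2l //; lia.
by rewrite ler_weXn2l //; lia.
Qed.

(** For i = a + t the two sums of squares differ by 2 t (t - d), which is at least |t| - 1 for every
    integer t; the case t = d = 1 forces the successor. *)
Lemma sum_squares_dist_le (a d i j : nat) :
  (d <= 1)%N -> (a + (a + d) = i + j)%N ->
  (a * a + (a + d) * (a + d) + ((i - a) + (a - i)) <= (i * i + j * j).+1)%N.
Proof.
case: d => [|[|//]] _ ?.
  by have [/subnK <-|/ltnW/subnK] := leqP a i; nia.
by have [/subnK <-|/ltnW/subnK] := leqP a i; nia.
Qed.

(** In 1024 q, the factor 256 comes from the lower bounds on |GL_i| and |GL_j|, q from the successor
    in [sum_squares_dist_le], and 4 from the sum over i. *)
Lemma Ngenus_le (R : realFieldType) (F : finFieldType) (n g a d : nat) (c : 'M[F]_n) :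
  c \in unitmx -> c - 1%:M \in unitmx -> (d <= 1)%N -> (a + (a + d) + g = n)%N ->
  (Ngenus g c)%:R * #|F|%:R ^+ (a * a + (a + d) * (a + d))
    <= 1024 * #|F|%:R * #|F|%:R ^+ (n * n) :> R.
Proof.
move=> cu c1 d1 dim; set q : R := #|F|%:R.
have q1 : 1 <= q by rewrite /q ler1n ltnW // finNzRing_gt1.
have qu : q != 0 by rewrite gt_eqF // (lt_le_trans _ q1).
have gn : (g <= n)%N by lia.
have := Ngenus_le_sum cu gn; rewrite -(ler_nat R) natr_sum => le_sum.
pose dist i := ((i - a) + (a - i))%N.
have le_term (i : 'I_(n - g).+1) :
    #|[set u : 'M[F]_n | (\rank (u - 1%:M)%R == (n - g - i) + g)%N && (\rank (u - c)%R == i + g)%N]|%:R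
      * q ^+ (a * a + (a + d) * (a + d)) <= 256 * q * q ^+ (n * n) * q^-1 ^+ dist i.
  have ie : (i + (n - g - i) + g = n)%N by have := ltn_ord i; lia.
  have := card_genus_le ie c1; set j := (n - g - i)%N in ie *.
  set x := #|_|; rewrite -(ler_nat R) !natrM natrX -/q.
  have := cardGL_ge R F i; have := cardGL_ge R F j; rewrite -/q.
  set Gi : R := (cardGL F i)%:R; set Gj : R := (cardGL F j)%:R => le_j le_i le_x.
  have x0 : 0 <= x%:R :> R by [].
  have qi : 0 <= q ^+ (i * i) by rewrite exprn_ge0 //; lra.
  have qj : 0 <= q ^+ (j * j) by rewrite exprn_ge0 //; lra.
  have : q ^+ (i * i) / 16 * (q ^+ (j * j) / 16) <= Gi * Gj.
    by apply: ler_pM => //; lra.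
  move=> /(ler_wpM2l x0)/le_trans/(_ le_x) {}le_x.
  have expE : (a * a + (a + d) * (a + d) + dist i <= (i * i + j * j).+1)%N.
    by apply: sum_squares_dist_le => //; rewrite /j; lia.
  rewrite exprVn ler_pdivlMr ?exprn_gt0 ?(lt_le_trans _ q1) // -[leLHS]mulrA -exprD.
  apply: (@le_trans _ _ (x%:R * q ^+ (i * i + j * j).+1)).
    by rewrite ler_wpM2l // ler_weXn2l.
  have q0 : 0 <= q by lra.
  rewrite exprS exprD; have := ler_wpM2l q0 le_x; lra.
have S0 : 0 <= q ^+ (a * a + (a + d) * (a + d)) by rewrite exprn_ge0 //; lra.
apply: le_trans (ler_wpM2r S0 le_sum) _; rewrite mulr_suml.
apply: le_trans (ler_sum _ (fun i _ => le_term i)) _.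
rewrite -mulr_sumr; have := sum_expr_dist_le4 a (n - g).+1 (invf_card_bounds R F).
have C0 : 0 <= 256 * q * q ^+ (n * n) by rewrite !mulr_ge0 ?exprn_ge0 //; lra.
by move=> /(ler_wpM2l C0) /le_trans; apply; lra.
Qed.

Lemma Ngenus_ge (R : realFieldType) (F : finFieldType) (n g a b : nat) (c : 'M[F]_n) :
  c \in unitmx -> c - 1%:M \in unitmx -> (7 <= a)%N -> (7 <= b)%N ->
  (a + b + g = n)%N ->
  #|F|%:R ^+ (n * n) / 256 / 32 <= (Ngenus g c)%:R * #|F|%:R ^+ (a * a + b * b) :> R.
Proof.
move=> cu c1 a7 b7 dim; apply: le_trans (card_genus_ge R dim a7 b7 cu c1) _.
apply: ler_pM => //.
  rewrite ler_nat (Ngenus_eq _ cu); apply/subset_leq_card/subsetP => u.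
  by rewrite !inE => /and3P[-> /eqP -> /eqP ->] /=; apply/eqP; lia.
by rewrite -natrX ler_nat expnD leq_mul ?cardGL_le.
Qed.

Theorem theorem5p1 (R : rcfType) (F : finFieldType) :
  exists c1 c2 : R, 0 < c1 /\ 0 < c2 /\
    forall g : nat, exists n0 : nat, forall n : nat, (n0 <= n)%N -> (0 < n)%N ->
      forall c : 'M[F]_n, regular_elliptic c ->
        c1 * theta_bound R F n g <= (@Ngenus F n g c)%:R <= c2 * theta_bound R F n g.
Proof.
pose q : R := #|F|%:R.
have q1 : 1 <= q by rewrite /q ler1n ltnW // finNzRing_gt1.
(* In the lower constant, 256 * 32 comes from [Ngenus_ge], 16 from |GL_g| >= q^(g^2) / 16, and q
   from the upper estimate of the square root; the upper constant is that of [Ngenus_le]. *)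
exists (256 * 32 * 16 * q)^-1, (1024 * q); rewrite invr_gt0; do 2![split; first by lra].
(* With n - g >= 15 both halves of n - g are at least 7. *)
move=> g; exists (g + 15)%N => n n0 _ c /regular_elliptic_units /andP[cu cu1].
have [d [d1 split_ng]] := half_split (n - g); set a := (n - g)./2 in split_ng.
have dim : (a + (a + d) + g = n)%N by lia.
have := sqrt_weight_bounds q1 d1 dim; have := Ngenus_le R cu cu1 d1 dim.
have a7 : (7 <= a)%N by lia.
have b7 : (7 <= a + d)%N by lia.
have := Ngenus_ge R cu cu1 a7 b7 dim; rewrite /theta_bound -/q.
set N : R := (Ngenus g c)%:R; set T := Num.sqrt _; set S := q ^+ (a * a + _).
rewrite !exprS !exprD; set Qn := q ^+ (n * n); set Qg := q ^+ (g * g).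
move=> lower upper /andP[le_T ge_T].
have S0 : 0 < S by rewrite exprn_gt0 //; lra.
have Qn0 : 0 <= Qn by rewrite exprn_ge0 //; lra.
have Qg0 : 0 < Qg by rewrite exprn_gt0 //; lra.
have N0 : 0 <= N by [].
have G0 : 0 < (cardGL F g)%:R :> R by rewrite ltr0n cardGL_gt0.
have := cardGL_ge R F g; rewrite -/q -/Qg => G_ge.
have G_le : (cardGL F g)%:R <= Qg by rewrite /Qg /q -natrX ler_nat cardGL_le.
set G : R := (cardGL F g)%:R in G0 G_ge G_le *.
apply/andP; split.
  (* After multiplication by S, the chain is T S <= q Qn Qg with Qn <= 256 * 32 N S and Qg <= 16
     G. *)
  rewrite mulrCA -mulrA mulrCA ler_pdivrMl; last by lra.
  rewrite mulrA ler_pdivrMr // -(ler_pM2r S0).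
  have NS0 : 0 <= N * S by rewrite mulr_ge0 // ltW.
  have q0 : 0 <= q by lra.
  have := ler_wpM2l (mulr_ge0 q0 (ltW Qg0)) lower.
  have := ler_wpM2l (mulr_ge0 q0 NS0) G_ge.
  lra.
(* Here N S G <= 1024 q Qn G, then G <= Qg and Qn Qg <= T S. *)
rewrite mulrA ler_pdivlMr // -(ler_pM2r S0).
have := ler_wpM2r (ltW G0) upper.
have q0 : 0 <= 1024 * q by lra.
have := ler_wpM2l (mulr_ge0 q0 Qn0) G_le.
have := ler_wpM2l q0 le_T.
lra.
Qed.
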